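(* Let $p$ be a prime, $m\ge 1$, $R=\mathbb{Z}/p^m\mathbb{Z}$, let $\Omega\subseteq \overline{R^k}$ be stable under multiplication by $R^\times$ and generate $R^k$, and let $C(\Omega)$ be the associated code. Assume that the dual code $C(\Omega)^\bot$, of length $n$, has exactly three nonzero homogeneous weights $w_1<w_2<w_3$. Let $b$ be any non-negative integer. Then: \begin{itemize} \item $\Omega$ is a triple sum set if and only if $w_1+w_2+w_3=3n(p-1)p^{m-2}$; \item $\Omega\cup\{0\}$ is a triple sum set if and only if $w_1+w_2+w_3=3\,\frac{1+n(p-1)p^{m-1}}{p}$; \item $\Gamma_{C(\Omega)}^b$ is a $3$-SWRG if and only if $w_1+w_2+w_3=3\,\frac{b+n(p-1)p^{m-1}}{p}$. \end{itemize}
   Context: Homogeneous weight on $R=\mathbb{Z}/p^m\mathbb{Z}$: $\mathrm{w}_{\mathrm{hom}}(0)=0$, $\mathrm{w}_{\mathrm{hom}}(x)=p^{m-1}$ if $0\ne x\in p^{m-1}R$, and $\mathrm{w}_{\mathrm{hom}}(x)=(p-1)p^{m-2}$ otherwise; it is extended additively to $R^n$. The homogeneous weights of a linear code are the weights of its nonzero codewords. The dual code is taken with respect to the standard inner product. $\overline{R^k}=\{\omega\in R^k : \{\omega\cdot x : x\in R^k\}=R\}$ is the set of regular vectors. For $\Omega\subseteq\overline{R^k}$ stable under multiplication by units, let $H$ be the $k\times n$ matrix whose columns form a system of representatives of $\Omega$ modulo multiplication by $R^\times$, so $n=|\Omega|/|R^\times|$. Then $C(\Omega)=\{x\in R^n: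 Hx=0\}$, and $C(\Omega)^\bot$ is the linear code generated by the rows of $H$. $\Gamma_{C(\Omega)}$ is the syndrome (coset) graph of $C(\Omega)$: its vertices are the syndromes $Hx$, $x\in R^n$, and two vertices are adjacent iff they differ by a unit multiple of a column of $H$. Since $\Omega$ generates $R^k$, it is the Cayley graph on $(R^k,+)$ with connection set $\Omega$. $\Gamma_{C(\Omega)}^b$ is obtained from it by adding $b$ loops at every vertex. A set $\Omega'\subseteq R^k$ is a triple sum set if it is stable under multiplication by units of $R$ and there are integer constants $\sigma_0,\sigma_1$ such that every nonzero $h\in R^k$ can be written as $h=x+y+z$ with $(x,y,z)\in\Omega'^3$ in exactly $\sigma_0$ ways if $h\in\Omega'$ and in exactly $\sigma_1$ ways if $h\notin\Omega'$. A graph (possibly with loops) is a $3$-SWRG (strongly walk-regular graph) if there are integers $\lambda,\mu,\nu$ such that the number of walks of length $3$ from $x$ to $y$ is $\lambda$ if $x\neq y$ are adjacent, $\mu$ if $x\ne y$ are non-adjacent, and $\nu$ if $x=y$. *)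

(* Defs.v *)
From HB Require Import structures.
From mathcomp Require Import all_boot all_order all_algebra.

Set Implicit Arguments.
Unset Strict Implicit.
Unset Printing Implicit Defensive.

Import Order.TTheory GRing.Theory Num.Theory.
Local Open Scope ring_scope.

(* Vectors of R^k and words of R^n are column vectors throughout. *)

Section Codes.
Variable R : finComUnitRingType.

Definition dot n (x y : 'cV[R]_n) : R := \sum_(i < n) x i 0 * y i 0.

Definition dual n (C : {set 'cV[R]_n}) : {set 'cV[R]_n} :=
  [set y | [forall x in C, dot x y == 0]].

Definition regular_vectors k : {set 'cV[R]_k} :=
  [set w | [set dot w x | x : 'cV[R]_k] == [set: R]].

Definition unit_stable k (Omega : {set 'cV[R]_k}) : Prop :=
  forall u w, u \is a GRing.unit -> w \in Omega -> u *: w \in Omega.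

Definition generating k (Omega : {set 'cV[R]_k}) : Prop :=
  forall v, exists c : 'cV[R]_k -> R, v = \sum_(w in Omega) c w *: w.

(* The columns of H are a system of representatives of Omega modulo
   multiplication by units. *)
Definition unit_representatives k n
    (Omega : {set 'cV[R]_k}) (H : 'M[R]_(k, n)) : Prop :=
  (forall j, col j H \in Omega) /\
  (forall w, w \in Omega ->
     exists! j, exists2 u, u \is a GRing.unit & w = u *: col j H).

Definition code k n (H : 'M[R]_(k, n)) : {set 'cV[R]_n} :=
  [set x | H *m x == 0].

Definition triple_sums k (Omega : {set 'cV[R]_k}) (h : 'cV[R]_k) :=
  [set t in setX (setX Omega Omega) Omega | h == t.1.1 + t.1.2 + t.2].

Definition triple_sum_set k (Omega : {set 'cV[R]_k}) : Prop :=
  unit_stable Omega /\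
  exists sigma0 sigma1 : int, forall h : 'cV[R]_k, h != 0 ->
    #|triple_sums Omega h|%:Z = if h \in Omega then sigma0 else sigma1.

End Codes.

Section HomogeneousWeight.
Variables p m : nat.

(* The values are rational and the exponent m - 2 is an integer, so that the
   formula also makes sense for m = 1. *)
Definition hom_weight (x : 'Z_(p ^ m)) : rat :=
  if x == 0 then 0
  else if [exists y : 'Z_(p ^ m), x == (p ^ m.-1)%:R * y] then p%:R ^+ m.-1
  else (p%:R - 1) * p%:R ^ (m%:Z - 2).

Definition word_hom_weight n (x : 'cV['Z_(p ^ m)]_n) : rat :=
  \sum_(i < n) hom_weight (x i 0).

Definition code_hom_weight n (C : {set 'cV['Z_(p ^ m)]_n}) (w : rat) : Prop :=
  exists c, [/\ c \in C, c != 0 & word_hom_weight c = w].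

End HomogeneousWeight.

(* A non-loop edge is represented by two opposite darts, a loop by a single
   dart: a loop at x yields exactly one closed walk of length 1 at x. *)
Record multigraph := Multigraph {
  vertex : finType;
  dart : finType;
  src : dart -> vertex;
  tgt : dart -> vertex }.

Section Walks.
Variable G : multigraph.

Definition adjacent (x y : vertex G) : bool :=
  [exists e : dart G, (src e == x) && (tgt e == y)].

Fixpoint is_walk (x : vertex G) (s : seq (dart G)) (y : vertex G) : bool :=
  if s is e :: s' then (src e == x) && is_walk (tgt e) s' y else x == y.

Definition nb_walks l (x y : vertex G) : nat :=
  #|[set s : l.-tuple (dart G) | is_walk x s y]|.

Definition swrg l : Prop :=
  exists lambda mu nu : int, forall x y : vertex G,
    (nb_walks l x y)%:Z =
      if x == y then nu else if adjacent x y then lambda else mu.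

End Walks.

Section SyndromeGraph.
Variables (R : finComUnitRingType) (k n : nat) (H : 'M[R]_(k, n)).

Definition syndromes : {set 'cV[R]_k} := [set H *m x | x : 'cV[R]_n].

Definition syndrome_vertex : finType := {s : 'cV[R]_k | s \in syndromes}.

Definition syndrome_adj (s t : syndrome_vertex) : bool :=
  [exists j, exists u : R,
     (u \is a GRing.unit) && (val s - val t == u *: col j H)].

Definition syndrome_arc : finType :=
  {st : syndrome_vertex * syndrome_vertex | syndrome_adj st.1 st.2}.

Definition syndrome_dart b : finType :=
  (syndrome_arc + syndrome_vertex * 'I_b)%type.

Definition syndrome_graph b : multigraph :=
  @Multigraph syndrome_vertex (syndrome_dart b)
    (fun e => match e with inl st => (val st).1 | inr si => si.1 end)
    (fun e => match e with inl st => (val st).2 | inr si => si.1 end).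

End SyndromeGraph.

(* Main.v *)
Require Import Defs.
From HB Require Import structures.
From mathcomp Require Import all_boot all_order all_algebra all_field.
From mathcomp Require Import ring.

Set Implicit Arguments.
Unset Strict Implicit.
Unset Printing Implicit Defensive.

Import Order.TTheory GRing.Theory Num.Theory.
Local Open Scope ring_scope.

(** Counting triples of [Omega] with a given sum, or walks of length 3 in the
    syndrome graph, is convolving three times the function equal to 1 on
    [Omega], to the number of loops at 0, and to 0 elsewhere: no loop for
    [Omega] itself, one for [0 |: Omega], and [b] for the graph. The three
    claims are thus a single one: the threefold convolution is constant on
    [Omega] and constant on the other nonzero vectors if and only if
    [w1 + w2 + w3] has a certain value.

    Take the Fourier transform for a faithful character of the additive group
    of R (a primitive root of unity of order p^m). At [h] the transform of
    [Omega] is the sum, over the columns of [H], of the values of the character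
    at the unit multiples of one coordinate of [H^T *m h]. Such a Ramanujan sum
    is an affine function of the homogeneous weight ([sum_chi_unit]), so that
    the eigenvalue at [h] is n(p-1)p^(m-1) - p w, where w is the weight of the
    codeword [H^T *m h] ([fourier_Omega]). As [Omega] generates R^k, these
    codewords are all the dual codewords and [h = 0] is the only one that gives
    the zero word ([dual_codeP], [trmx_mul_eq0]).
    With b loops the eigenvalues for nonzero [h] are therefore exactly three
    distinct numbers t_i = b + n(p-1)p^(m-1) - p w_i.

    Convolution becomes multiplication, and a function whose transform
    vanishes off 0 is constant. The threefold convolution is therefore
    two-valued on nonzero vectors if and only if t_i^3 = a t_i + c for some a
    and c independent of i ([two_valued_conv3]). A monic cubic with roots t_1,
    t_2, t_3 has no quadratic term if and only if t_1 + t_2 + t_3 = 0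
    ([cubic_no_square]), which is the condition on the weights. *)

(** * Bilinearity of the inner product *)

Section Dot.
Variable R : finComUnitRingType.

Lemma dotC k (x y : 'cV[R]_k) : dot x y = dot y x.
Proof. by apply: eq_bigr => i _; rewrite mulrC. Qed.

Lemma dotDl k (x y z : 'cV[R]_k) : dot (x + y) z = dot x z + dot y z.
Proof. by rewrite -big_split; apply: eq_bigr => i _; rewrite mxE mulrDl. Qed.

Lemma dotDr k (x y z : 'cV[R]_k) : dot z (x + y) = dot z x + dot z y.
Proof. by rewrite ![dot z _]dotC dotDl. Qed.

Lemma dotZr k a (x y : 'cV[R]_k) : dot x (a *: y) = a * dot x y.
Proof.
by rewrite /dot mulr_sumr; apply: eq_bigr => i _; rewrite mxE mulrCA.
Qed.

Lemma dot0r k (x : 'cV[R]_k) : dot x 0 = 0.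
Proof. by rewrite -(scale0r 0) dotZr mul0r. Qed.

Lemma dot0l k (x : 'cV[R]_k) : dot 0 x = 0.
Proof. by rewrite dotC dot0r. Qed.

Lemma dot_deltal k (i : 'I_k) (x : 'cV[R]_k) : dot (delta_mx i 0) x = x i 0.
Proof.
rewrite /dot (bigD1 i) //= big1 => [|j ne_ji]; last first.
  by rewrite mxE (negbTE ne_ji) mul0r.
by rewrite mxE !eqxx mul1r addr0.
Qed.

Lemma dot_mulmx k n (H : 'M[R]_(k, n)) h x :
  dot (H^T *m h) x = dot h (H *m x).
Proof.
rewrite /dot (eq_bigr (fun j => \sum_i h i 0 * (H i j * x j 0))); last first.
  move=> j _; rewrite mxE mulr_suml; apply: eq_bigr => i _.
  by rewrite mxE mulrCA mulrA.
rewrite exchange_big; apply: eq_bigr => i _.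
by rewrite mxE mulr_sumr.
Qed.

End Dot.

(** * Fourier analysis on R^k *)

Section Fourier.
Variables (R : finComUnitRingType) (C : numFieldType) (chi : R -> C).
Hypothesis chi0 : chi 0 = 1.
Hypothesis chiD : forall a b, chi (a + b) = chi a * chi b.
Hypothesis chi_faithful : forall a, chi a = 1 -> a = 0.
Variable k : nat.
Implicit Types (f g : 'cV[R]_k -> C) (h v x y : 'cV[R]_k).

Definition fourier f h : C := \sum_x f x * chi (dot h x).

Definition conv f g y : C := \sum_x f x * g (y - x).

Definition delta v : C := (v == 0)%:R.

Definition conv_pow l f : 'cV[R]_k -> C := iter l (conv f) delta.

Lemma sum_delta (F : 'cV[R]_k -> C) v : \sum_x F x * delta (v - x) = F v.
Proof.
rewrite (bigD1 v) //= big1 => [|x ne_xv]; rewrite /delta.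
  by rewrite subrr eqxx mulr1 addr0.
by rewrite subr_eq0 eq_sym (negbTE ne_xv) mulr0.
Qed.

Lemma eq_fourier f g : f =1 g -> fourier f =1 fourier g.
Proof. by move=> fg h; apply: eq_bigr => x _; rewrite fg. Qed.

Lemma fourierD f g h :
  fourier (fun x => f x + g x) h = fourier f h + fourier g h.
Proof. by rewrite -big_split; apply: eq_bigr => x _; rewrite mulrDl. Qed.

Lemma fourierZ a f h : fourier (fun x => a * f x) h = a * fourier f h.
Proof. by rewrite /fourier mulr_sumr; apply: eq_bigr => x _; rewrite mulrA. Qed.

Lemma fourier_delta h : fourier delta h = 1.
Proof.
rewrite /fourier (bigD1 0) //= big1 => [|x /negbTE ne_x0]; rewrite /delta.
  by rewrite eqxx dot0r chi0 mulr1 addr0.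
by rewrite ne_x0 mul0r.
Qed.

(** A sum of values of a nontrivial character is multiplied by a factor other
    than 1 under a translation of the summation variable. *)
Lemma sum_chi_dot v :
  \sum_h chi (dot h v) = if v == 0 then #|{: 'cV[R]_k}|%:R else 0.
Proof.
have [->|nz_v] := eqVneq v 0.
  rewrite -sum1_card natr_sum; apply: eq_bigr => h _.
  by rewrite dot0r chi0.
have [i nz_vi] : exists i, v i 0 != 0.
  apply/existsP; apply: contraR nz_v => /existsPn v0.
  by apply/eqP/matrixP => i j; rewrite ord1 mxE; apply/eqP/negbNE/v0.
set S := \sum_h _.
have eqS : S = chi (v i 0) * S.
  rewrite {1}/S (reindex_inj (addrI (delta_mx i 0))) mulr_sumr.
  by apply: eq_bigr => h _; rewrite dotDl dot_deltal chiD.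
have /eqP : (1 - chi (v i 0)) * S = 0 by rewrite mulrBl mul1r -eqS subrr.
rewrite mulf_eq0 subr_eq0 => /orP[/eqP/esym/chi_faithful v0|/eqP//].
by rewrite v0 eqxx in nz_vi.
Qed.

Lemma fourier_const c h : h != 0 -> fourier (fun=> c) h = 0.
Proof.
move=> nz_h; rewrite /fourier -mulr_sumr.
under eq_bigr => x _ do rewrite dotC.
by rewrite sum_chi_dot (negbTE nz_h) mulr0.
Qed.

Lemma fourier_conv f g h : fourier (conv f g) h = fourier f h * fourier g h.
Proof.
rewrite /fourier /conv.
under eq_bigr => y _ do rewrite mulr_suml.
rewrite exchange_big mulr_suml; apply: eq_bigr => x _ /=.
rewrite (reindex_inj (addIr x)) mulr_sumr; apply: eq_bigr => y _.
by rewrite addrK dotDr chiD; ring.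
Qed.

Lemma fourier_conv_pow l f h : fourier (conv_pow l f) h = fourier f h ^+ l.
Proof.
elim: l => [|l IHl]; first exact: fourier_delta.
by rewrite exprS -IHl -fourier_conv.
Qed.

(** In the inversion formula only the trivial character contributes. *)
Lemma fourier_eq0_const f :
  (forall h, h != 0 -> fourier f h = 0) -> forall x, f x = f 0.
Proof.
move=> f0; set q := #|{: 'cV[R]_k}|%:R : C.
have nz_q : q != 0.
  by rewrite pnatr_eq0 -lt0n; apply/card_gt0P; exists 0.
suffices inv y : f y * q = fourier f 0.
  by move=> x; apply: (mulIf nz_q); rewrite !inv.
have termE x : \sum_h f x * chi (dot h x) * chi (dot h (- y))
             = f x * (if x == y then q else 0).
  under eq_bigr => h _ do rewrite -mulrA -chiD -dotDr.
  by rewrite -mulr_sumr sum_chi_dot subr_eq0.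
transitivity (\sum_h fourier f h * chi (dot h (- y))).
  under [RHS]eq_bigr => h _ do rewrite /fourier mulr_suml.
  rewrite exchange_big /= (eq_bigr _ (fun x _ => termE x)) (bigD1 y) //= eqxx.
  by rewrite big1 ?addr0 // => x /negbTE->; rewrite mulr0.
rewrite (bigD1 0) //= big1 ?addr0 => [|h nz_h]; last by rewrite f0 ?mul0r.
by rewrite dot0l chi0 mulr1.
Qed.

End Fourier.

(** * The cubic criterion *)

Section TwoValued.
Variables (V : finZmodType) (T : Type) (A : {set V}).

(** The value at 0 is unconstrained: both triple sum sets and walk-regularity
    leave it free. *)
Definition two_valued (N : V -> T) : Prop :=
  forall x y, x != 0 -> y != 0 -> (x \in A) = (y \in A) -> N x = N y.

Lemma two_valuedP (N : V -> T) :
  (exists s0 s1, forall x, x != 0 -> N x = if x \in A then s0 else s1)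
  <-> two_valued N.
Proof.
split=> [[s0 [s1 eN]] x y nz_x nz_y eA|tvN]; first by rewrite !eN // eA.
pose s c :=
  if [pick x | (x != 0) && ((x \in A) == c)] is Some x then N x else N 0.
have sE x : x != 0 -> N x = s (x \in A).
  move=> nz_x; rewrite /s.
  case: pickP => [y /andP[nz_y /eqP eA]|/(_ x)]; first exact: tvN.
  by rewrite nz_x eqxx.
by exists (s true), (s false) => x /sE->; case: (x \in A).
Qed.

End TwoValued.

Section Cubic.
Variable C : numFieldType.

(** The antisymmetrisation of t1^3 (t2 - t3) is the Vandermonde product times
    t1 + t2 + t3, and it vanishes on affine functions; conversely the monic
    cubic with roots t1, t2, t3 has quadratic coefficient -(t1 + t2 + t3). *)
Lemma cubic_no_square (t1 t2 t3 : C) : t1 != t2 -> t1 != t3 -> t2 != t3 ->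
  (exists a c, forall t, t \in [:: t1; t2; t3] -> t ^+ 3 = a * t + c)
  <-> t1 + t2 + t3 = 0.
Proof.
move=> n12 n13 n23; split=> [[a [c Ht]]|s0].
  have [e1 e2 e3] : [/\ t1 ^+ 3 = a * t1 + c, t2 ^+ 3 = a * t2 + c
                      & t3 ^+ 3 = a * t3 + c].
    by split; apply: Ht; rewrite !inE eqxx ?orbT.
  have /eqP : (t1 - t2) * (t1 - t3) * (t2 - t3) * (t1 + t2 + t3) = 0.
    transitivity (t1 ^+ 3 * (t2 - t3) + t2 ^+ 3 * (t3 - t1)
                  + t3 ^+ 3 * (t1 - t2)); first by ring.
    by rewrite e1 e2 e3; ring.
  by rewrite !mulf_eq0 !subr_eq0 (negbTE n12) (negbTE n13) (negbTE n23) => /eqP.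
exists (- (t1 * t2 + t1 * t3 + t2 * t3)), (t1 * t2 * t3) => t tin.
have root_t : (t - t1) * (t - t2) * (t - t3) = 0.
  by move: tin; rewrite !inE => /or3P[] /eqP->; rewrite subrr ?(mulr0, mul0r).
transitivity (- (t1 * t2 + t1 * t3 + t2 * t3) * t + t1 * t2 * t3
  + (t - t1) * (t - t2) * (t - t3) + t ^+ 2 * (t1 + t2 + t3)); first by ring.
by rewrite root_t s0 mulr0 !addr0.
Qed.

End Cubic.

Section Criterion.
Variables (R : finComUnitRingType) (C : numFieldType) (chi : R -> C).
Hypothesis chi0 : chi 0 = 1.
Hypothesis chiD : forall a b, chi (a + b) = chi a * chi b.
Hypothesis chi_faithful : forall a, chi a = 1 -> a = 0.
Variables (k : nat) (A : {set 'cV[R]_k}) (b : C).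

(** The number of darts between two vertices of the Cayley graph on A with b
    loops everywhere, as a function of the difference of the vertices. *)
Definition looped (x : 'cV[R]_k) : C := (x \in A)%:R + b * delta C x.

Lemma fourier_looped h :
  fourier chi looped h = fourier chi (fun x => (x \in A)%:R) h + b.
Proof. by rewrite fourierD fourierZ fourier_delta ?mulr1. Qed.

(** Away from 0 a two-valued function is a combination of the indicator of A
    and a constant; the transform turns this into an affine relation between
    the cube of each nontrivial eigenvalue and the eigenvalue. *)
Lemma two_valued_conv3 (t1 t2 t3 : C) :
    0 \notin A -> t1 != t2 -> t1 != t3 -> t2 != t3 ->
    (forall t, (exists2 h, h != 0 & fourier chi looped h = t)
               <-> t \in [:: t1; t2; t3]) ->
  two_valued A (conv_pow 3 looped) <-> t1 + t2 + t3 = 0.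
Proof.
move=> A0 n12 n13 n23 spec; pose N := conv_pow 3 looped.
have hatN h : fourier chi N h = fourier chi looped h ^+ 3.
  by rewrite fourier_conv_pow.
split=> [/two_valuedP[s0 [s1 Ns]]|].
  apply/(cubic_no_square n12 n13 n23).
  (* The constant c absorbs the value of N at 0. *)
  pose c := N 0 - s1 - (s0 - s1) * b.
  exists (s0 - s1), c => _ /spec[h nz_h <-].
  have eN : N =1 fun x => ((s0 - s1) * looped x + c * delta C x) + s1.
    move=> x; rewrite /looped /delta; have [->|nz_x] := eqVneq x 0.
      by rewrite (negbTE A0) mulr0n mulr1n /c; ring.
    rewrite /N Ns //= mulr0n.
    by case: (x \in A); rewrite ?mulr1n ?mulr0n; ring.
  rewrite -hatN (eq_fourier _ eN) !fourierD !fourierZ fourier_const //.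
  by rewrite !fourier_delta // !mulr1 addr0 fourier_looped.
move/(cubic_no_square n12 n13 n23) => [a [c Ht]].
(* The transform of F is the cubic with roots t1, t2, t3 at the eigenvalue. *)
pose F x := N x + (- a * looped x + - c * delta C x).
have F0 h : h != 0 -> fourier chi F h = 0.
  move=> nz_h; rewrite !fourierD !fourierZ fourier_delta // hatN Ht.
    by rewrite mulr1; ring.
  by apply/spec; exists h.
have Fc x : x != 0 -> N x = a * (x \in A)%:R + F 0.
  move=> nz_x; rewrite -(fourier_eq0_const chi0 chiD chi_faithful F0 x) /F.
  by rewrite /looped /delta (negbTE nz_x) mulr0n; ring.
by move=> x y nz_x nz_y eA; rewrite -/N !Fc // eA.
Qed.

End Criterion.

(** * Counting by convolution powers *)

Lemma card_triple_sums (R : finComUnitRingType) (C : numFieldType) k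
    (S : {set 'cV[R]_k}) h :
  #|triple_sums S h|%:R = conv_pow 3 (fun x => (x \in S)%:R : C) h.
Proof.
pose ind x : C := (x \in S)%:R.
transitivity (\sum_x \sum_y \sum_z
                ind x * (ind y * (ind z * delta C (h - x - y - z)))).
  rewrite -sum1_card natr_sum big_mkcond !pair_bigA.
  apply: eq_bigr => -[[x y] z] _ /=.
  have -> : delta C (h - x - y - z) = (h == x + y + z)%:R.
    by rewrite /delta -!addrA -!opprD subr_eq0.
  rewrite !inE /ind /=.
  by do 4!case: (_ \in S) => /=; rewrite ?mul0r ?mulr0 // !mul1r; case: eqP.
rewrite /conv_pow /= /conv; apply: eq_bigr => x _.
by rewrite mulr_sumr; apply: eq_bigr => y _; rewrite !mulr_sumr.
Qed.

Lemma nb_walksS (G : multigraph) l (x y : vertex G) :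
  nb_walks l.+1 x y = (\sum_(e : dart G | src e == x) nb_walks l (tgt e) y)%N.
Proof.
rewrite /nb_walks -sum1dep_card.
under [RHS]eq_bigr => e _ do rewrite -sum1dep_card.
rewrite pair_big_dep /= (reindex (fun p : dart G * l.-tuple (dart G) =>
                                    [tuple of p.1 :: p.2])) //=.
exists (fun s => (thead s, [tuple of behead s])) => [[e s]|s] _ /=.
  by rewrite theadE; congr pair; apply: val_inj.
by rewrite [RHS]tuple_eta; apply: val_inj.
Qed.

Section SyndromeWalks.
Variables (R : finComUnitRingType) (k n : nat) (Omega : {set 'cV[R]_k}).
Variable H : 'M[R]_(k, n).
Hypothesis Omega_stable : unit_stable Omega.
Hypothesis H_repr : unit_representatives Omega H.
Hypothesis H_onto : forall v, exists x : 'cV_n, v = H *m x.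

Lemma mem_Omega_col w :
  (w \in Omega)
  = [exists j, exists u : R, (u \is a GRing.unit) && (w == u *: col j H)].
Proof.
apply/idP/existsP => [|[j /existsP[u /andP[Uu /eqP->]]]].
  move=> /(H_repr.2)[j [[u Uu ->] _]].
  by exists j; apply/existsP; exists u; rewrite Uu eqxx.
exact: Omega_stable Uu (H_repr.1 j).
Qed.

Lemma syndrome_adjE (s t : syndrome_vertex H) :
  syndrome_adj s t = (val s - val t \in Omega).
Proof. by rewrite mem_Omega_col. Qed.

Lemma mem_syndromes v : v \in syndromes H.
Proof. by have [x ->] := H_onto v; apply: imset_f. Qed.

Variable b : nat.

Lemma adjacent_syndrome (x y : vertex (syndrome_graph H b)) :
  x != y -> adjacent x y = (val x - val y \in Omega).
Proof.
move=> ne_xy; rewrite -syndrome_adjE.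
apply/existsP/idP => [[[a|[s i]]]|adj_xy] /=.
- by case/andP=> /eqP<- /eqP<-; apply: (valP a).
- by case/andP=> /eqP-> /eqP exy; rewrite exy eqxx in ne_xy.
exists (inl (exist (fun st => syndrome_adj st.1 st.2) (x, y) adj_xy)).
by rewrite /= !eqxx.
Qed.

Variable C : numFieldType.

(** Summing over the darts that leave x is applying the adjacency matrix: the
    arcs contribute the indicator of Omega and the loops the multiple of the
    identity. *)
Lemma sum_darts_from (x : vertex (syndrome_graph H b)) (F : 'cV[R]_k -> C) :
  \sum_(e : dart (syndrome_graph H b) | src e == x) F (val (tgt e))
  = \sum_v looped Omega b%:R (val x - v) * F v.
Proof.
rewrite big_sumType /=.
under [RHS]eq_bigr => v _ do rewrite mulrDl.
rewrite big_split /=; congr (_ + _).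
  transitivity (\sum_(st : syndrome_vertex H * syndrome_vertex H
                      | syndrome_adj st.1 st.2 && (st.1 == x)) F (val st.2)).
    by rewrite (big_sub_cond (fun st => syndrome_adj st.1 st.2)).
  rewrite (eq_bigl (fun st => (st.1 == x) && syndrome_adj x st.2)); last first.
    by move=> [s t] /=; rewrite andbC; have [->|] := eqVneq s x.
  rewrite -(pair_big_dep (pred1 x) (fun _ => syndrome_adj x)
                         (fun _ t => F (val t))) /= big_pred1_eq.
  transitivity (\sum_(t in syndromes H | val x - t \in Omega) F t).
    rewrite big_sub_cond; apply: eq_bigl => t; exact: syndrome_adjE.
  rewrite big_mkcond; apply: eq_bigr => v _; rewrite mem_syndromes /=.
  by case: (_ \in Omega); rewrite ?mul1r ?mul0r.
transitivity (\sum_(si : syndrome_vertex H * 'I_b | (si.1 == x) && true)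
                F (val si.1)).
  by apply: eq_bigl => si; rewrite andbT.
rewrite -(pair_big (pred1 x) xpredT (fun s _ => F (val s))) /= big_pred1_eq.
rewrite sumr_const card_ord -[F _ *+ b]mulr_natl.
under [RHS]eq_bigr => v _ do rewrite mulrAC.
by rewrite sum_delta.
Qed.

Lemma nb_walks_conv_pow l (x y : vertex (syndrome_graph H b)) :
  (nb_walks l x y)%:R = conv_pow l (looped Omega b%:R : _ -> C) (val x - val y).
Proof.
elim: l x => [|l IHl] x.
  rewrite /conv_pow /= /delta subr_eq0 (inj_eq val_inj) /nb_walks.
  case: eqP => [->|ne_xy].
    rewrite (_ : [set s | _] = [set: _]) ?cardsT ?card_tuple //.
    by apply/setP=> s; rewrite tuple0 !inE /= eqxx.
  rewrite (_ : [set s | _] = set0) ?cards0 //.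
  by apply/setP=> s; rewrite tuple0 !inE /=; apply/eqP.
rewrite nb_walksS natr_sum; under eq_bigr => e _ do rewrite IHl.
rewrite (sum_darts_from x
           (fun v => conv_pow l (looped Omega b%:R) (v - val y))).
rewrite (reindex_inj (inj_comp (addrI (val x)) oppr_inj)) /=.
by apply: eq_bigr => v _; rewrite subKr addrAC.
Qed.

End SyndromeWalks.

(** * The code and its dual *)

Section Dual.
Variables (R : finComUnitRingType) (k n : nat) (Omega : {set 'cV[R]_k}).
Variable H : 'M[R]_(k, n).
Hypothesis Omega_gen : generating Omega.
Hypothesis H_repr : unit_representatives Omega H.

Lemma generating_onto v : exists x : 'cV_n, v = H *m x.
Proof.
have [c ->] := Omega_gen v.
apply: (big_ind (fun v => exists x : 'cV_n, v = H *m x)) =>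
  [|_ _ [x ->] [y ->]|w].
- by exists 0; rewrite mulmx0.
- by exists (x + y); rewrite mulmxDr.
move=> /(H_repr.2)[j [[u _ ->] _]].
exists (c (u *: col j H) *: (u *: delta_mx j 0)).
by rewrite -!scalemxAr -colE.
Qed.

(** A word orthogonal to the kernel of H defines a linear form on the image of
    H, which is the whole of R^k; h collects its values at the basis vectors. *)
Lemma dual_codeP y :
  reflect (exists h : 'cV_k, y = H^T *m h) (y \in dual (code H)).
Proof.
apply: (iffP idP) => [|[h ->]]; last first.
  rewrite inE; apply/forall_inP => x; rewrite inE => /eqP Hx.
  by rewrite dotC dot_mulmx Hx dot0r.
rewrite inE => /forall_inP y_dual.
have [X HX] : exists X : 'I_k -> 'cV[R]_n, forall i, delta_mx i 0 = H *m X i.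
  exact: fin_all_exists (fun i => generating_onto (delta_mx i 0)).
pose h := \col_i dot y (X i); exists h; apply/colP => j.
pose e := delta_mx j 0 : 'cV[R]_n.
pose x := \sum_i (H *m e) i 0 *: X i.
have Hx : H *m x = H *m e.
  rewrite mulmx_sumr [RHS]matrix_sum_delta; apply: eq_bigr => i _.
  by rewrite big_ord1 -scalemxAr -HX.
have /eqP : dot (e - x) y == 0.
  by apply: y_dual; rewrite inE mulmxBr Hx subrr.
rewrite dotC dotDr -scaleN1r dotZr mulN1r => /eqP; rewrite subr_eq0.
have dot_sumr z (s : 'I_k -> 'cV[R]_n) :
  dot z (\sum_i s i) = \sum_i dot z (s i).
  by apply: (big_morph (dot z)) => [u v|]; rewrite ?dotDr ?dot0r.
rewrite dot_sumr dotC dot_deltal => /eqP->.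
transitivity (dot (H^T *m h) e); last by rewrite dotC dot_deltal.
rewrite dot_mulmx; apply: eq_bigr => i _.
by rewrite dotZr !mxE mulrC.
Qed.

Lemma trmx_mul_eq0 (h : 'cV_k) : (H^T *m h == 0) = (h == 0).
Proof.
apply/eqP/eqP => [Hh0|->]; last by rewrite mulmx0.
apply/colP => i; rewrite mxE -dot_deltal dotC.
by have [x ->] := generating_onto (delta_mx i 0); rewrite -dot_mulmx Hh0 dot0l.
Qed.

Lemma regular_scale_inj w :
  w \in regular_vectors R k -> injective (fun u => u *: w).
Proof.
rewrite inE => /eqP im_w u u' eq_uw.
have /imsetP[x _ wx1] : 1 \in [set dot w x | x : 'cV[R]_k] by rewrite im_w inE.
by rewrite -[u]mulr1 -[u']mulr1 wx1 dotC -!dotZr eq_uw.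
Qed.

(** The units act freely on regular vectors, so that Omega is in bijection with
    the pairs formed by a column of H and a unit. *)
Lemma sum_unit_orbits (C : numFieldType) (F : 'cV[R]_k -> C) :
    Omega \subset regular_vectors R k -> unit_stable Omega ->
  \sum_(w in Omega) F w
  = \sum_j \sum_(u : R | u \is a GRing.unit) F (u *: col j H).
Proof.
move=> Omega_regular Omega_stable; pose h (p : 'I_n * R) := p.2 *: col p.1 H.
have eqOmega : Omega = h @: [pred p : 'I_n * R | p.2 \is a GRing.unit].
  apply/setP=> w; apply/idP/imsetP => [|[[j u] /= Uu ->]].
    by move=> /(H_repr.2)[j [[u Uu ->] _]]; exists (j, u).
  exact: Omega_stable Uu (H_repr.1 j).
rewrite {1}eqOmega big_imset /=; last first.
  move=> [j u] [j' u'] /= Uu Uu' eh.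
  have [j0 [_ j0_uniq]] := H_repr.2 _ (Omega_stable _ _ Uu (H_repr.1 j)).
  have ej : j = j'.
    transitivity j0; first by apply/esym/j0_uniq; exists u.
    by apply: j0_uniq; exists u'.
  rewrite -{}ej in eh *; congr pair.
  exact: (regular_scale_inj (subsetP Omega_regular _ (H_repr.1 j))).
by rewrite pair_big_dep.
Qed.

End Dual.

(** * Character sums over the units and the homogeneous weight *)

Section Ramanujan.
Variables p m : nat.
Hypothesis p_prime : prime p.
Hypothesis m_gt0 : (0 < m)%N.
Local Notation R := 'Z_(p ^ m).

Let p_gt0 : (0 < p)%N := prime_gt0 p_prime.

Lemma expn_prime_gt1 : (1 < p ^ m)%N.
Proof. by rewrite -(expn0 p) ltn_exp2l // prime_gt1. Qed.

Let q_gt1 := expn_prime_gt1.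

Lemma natr_Zp_eq0 x : ((x%:R : R) == 0) = (p ^ m %| x)%N.
Proof. by rewrite -val_eqE /= val_Zp_nat. Qed.

Lemma natr_Zp_val (a : R) : (val a)%:R = a.
Proof. exact: natr_Zp. Qed.

Lemma natr_Zp_unit x : ((x%:R : R) \is a GRing.unit) = ~~ (p %| x)%N.
Proof. by rewrite unitZpE // coprime_pexpl // prime_coprime. Qed.

Lemma card_Zp_nonunit :
  #|[pred u : R | u \isn't a GRing.unit]| = (p ^ m.-1)%N.
Proof.
have cardU : #|[pred u : R | u \is a GRing.unit]| = (p.-1 * p ^ m.-1)%N.
  rewrite -totient_pfactor // -card_units_Zp ?expn_gt0 ?p_gt0 //.
  by rewrite cardsT card_sub.
apply: (@addnI (p.-1 * p ^ m.-1)%N).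
rewrite -mulSnr prednK // -expnS prednK //.
transitivity #|{: R}|; last by rewrite card_ord Zp_cast.
rewrite -cardU -[RHS](cardC [pred u : R | u \is a GRing.unit]).
by congr addn; apply: eq_card => u; rewrite !inE.
Qed.

(** The annihilator of p is the minimal ideal; this form of membership is the
    one that the character sum over the nonunits produces. *)
Lemma socleP (a : R) :
  [exists y : R, a == (p ^ m.-1)%:R * y] = (p%:R * a == 0).
Proof.
apply/existsP/idP => [[y /eqP->]|].
  rewrite mulrA -natrM -expnS prednK // -(natr_Zp_val y) -natrM natr_Zp_eq0.
  exact: dvdn_mulr.
rewrite -{1}(natr_Zp_val a) -natrM natr_Zp_eq0 -{1}(prednK m_gt0) expnS.
rewrite dvdn_pmul2l // => /dvdnP[c ec].
by exists c%:R; rewrite -natrM mulnC -ec natr_Zp_val.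
Qed.

Variable z : algC.
Hypothesis z_prim : (p ^ m)%N.-primitive_root z.

Definition chi (a : R) : algC := z ^+ val a.

Lemma chi_natr x : chi x%:R = z ^+ x.
Proof. by rewrite /chi /= val_Zp_nat // prim_expr_mod. Qed.

Lemma chi0 : chi 0 = 1.
Proof. exact: expr0. Qed.

Lemma chiD a b : chi (a + b) = chi a * chi b.
Proof. by rewrite -(natr_Zp_val a) -(natr_Zp_val b) -natrD !chi_natr exprD. Qed.

Lemma chi_faithful a : chi a = 1 -> a = 0.
Proof.
move/eqP; rewrite -(prim_order_dvd z_prim) => dv.
by apply/eqP; rewrite -(natr_Zp_val a) natr_Zp_eq0.
Qed.

(** The nontrivial character u |-> chi (u * a) multiplies the sum by a factor
    other than 1 when the summation set is translated by g. This serves for all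
    of R with g = 1, and for the ideal of nonunits with g = p. *)
Lemma sum_chi_periodic (D : pred R) g a :
    (forall u, D (u + g) = D u) -> g * a != 0 -> \sum_(u | D u) chi (u * a) = 0.
Proof.
move=> Dg nz_ga; set S := \sum_(u | _) _.
have eS : S = S * chi (g * a).
  rewrite {1}/S (reindex_inj (addIr g)) mulr_suml (eq_bigl _ _ Dg).
  by apply: eq_bigr => u _; rewrite mulrDl chiD.
have /eqP : S * (1 - chi (g * a)) = 0 by rewrite mulrBr mulr1 -eS subrr.
rewrite mulf_eq0 subr_eq0 => /orP[/eqP//|/eqP/esym/chi_faithful ga0].
by rewrite ga0 eqxx in nz_ga.
Qed.

Lemma sum_chi_all (a : R) :
  \sum_u chi (u * a) = if a == 0 then (p ^ m)%:R else 0.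
Proof.
have [->|nz_a] := eqVneq a 0.
  under eq_bigr => u _ do rewrite mulr0 chi0.
  by rewrite sumr_const card_ord Zp_cast.
by apply: (@sum_chi_periodic xpredT 1); rewrite ?mul1r.
Qed.

Lemma sum_chi_nonunit (a : R) :
  \sum_(u : R | u \isn't a GRing.unit) chi (u * a)
  = if p%:R * a == 0 then (p ^ m.-1)%:R else 0.
Proof.
have [pa0|nz_pa] := eqVneq (p%:R * a) 0.
  rewrite -card_Zp_nonunit -sum1_card natr_sum; apply: eq_bigr => u.
  rewrite -(natr_Zp_val u) natr_Zp_unit negbK => /dvdnP[c ->].
  by rewrite natrM -mulrA pa0 mulr0 chi0.
apply: (@sum_chi_periodic _ p%:R) nz_pa => u.
by rewrite -(natr_Zp_val u) -natrD !natr_Zp_unit dvdn_addl.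
Qed.

Lemma mul_exprz_sub2 : (p%:R : rat) * p%:R ^ (m%:Z - 2) = p%:R ^+ m.-1.
Proof.
have nz_p : (p%:R : rat) != 0 by rewrite pnatr_eq0 -lt0n.
rewrite -{1}[p%:R]expr1z -expfzDr // -{1}(prednK m_gt0).
by rewrite (_ : 1 + _ = m.-1%:Z) // -addn1 PoszD; ring.
Qed.

(** Up to an affine normalisation the homogeneous weight is the sum of the
    values of a faithful additive character over the units: both sides only
    distinguish zero, the rest of the minimal ideal, and everything else. *)
Lemma sum_chi_unit (a : R) :
  \sum_(u : R | u \is a GRing.unit) chi (u * a)
  = ratr ((p%:R - 1) * p%:R ^+ m.-1 - p%:R * hom_weight a).
Proof.
have -> : \sum_(u : R | u \is a GRing.unit) chi (u * a)
    = (if a == 0 then (p ^ m)%:R else 0)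
      - (if p%:R * a == 0 then (p ^ m.-1)%:R else 0).
  rewrite -sum_chi_all -sum_chi_nonunit.
  rewrite [X in _ = X - _](bigID (fun u : R => u \is a GRing.unit)) /=.
  by rewrite addrK.
have eq_pm : (p ^ m)%:R = p%:R * p%:R ^+ m.-1 :> rat.
  by rewrite natrX -exprS prednK.
rewrite /hom_weight socleP; have [->|nz_a] := eqVneq a 0.
  rewrite mulr0 eqxx mulr0 subr0 mulrBl mul1r -eq_pm -natrX.
  by rewrite rmorphB /= !ratr_nat.
rewrite sub0r; case: ifP => _.
  by rewrite mulrBl mul1r addrAC subrr sub0r rmorphN /= -natrX ratr_nat.
by rewrite mulrCA mul_exprz_sub2 subrr oppr0 rmorph0.
Qed.

Lemma hom_weight_ge0 (a : R) : 0 <= hom_weight a.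
Proof.
have p1 : (0 : rat) <= p%:R - 1 by rewrite subr_ge0 ler1n.
rewrite /hom_weight; case: ifP => // _; case: ifP => _.
  by rewrite exprn_ge0 ?ler0n.
by rewrite mulr_ge0 // exprz_ge0 ?ler0n.
Qed.

Lemma hom_weight_eq0 (a : R) : (hom_weight a == 0) = (a == 0).
Proof.
have nz_p : (p%:R : rat) != 0 by rewrite pnatr_eq0 -lt0n.
rewrite /hom_weight; have [//|_] := eqVneq a 0; rewrite ?eqxx //.
case: ifP => _; first by rewrite expf_eq0 (negbTE nz_p) andbF.
apply/negbTE; rewrite mulf_neq0 ?expfz_neq0 // subr_eq0.
by rewrite pnatr_eq1 neq_ltn prime_gt1 ?orbT.
Qed.

Lemma word_hom_weight_eq0 n (x : 'cV[R]_n) :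
  (word_hom_weight x == 0) = (x == 0).
Proof.
rewrite /word_hom_weight psumr_eq0 => [|i _]; last exact: hom_weight_ge0.
apply/allP/eqP => [x0|-> i _]; last by rewrite mxE hom_weight_eq0.
apply/colP => i; rewrite mxE; apply/eqP; rewrite -hom_weight_eq0.
by apply: (implyP (x0 i _)); rewrite ?mem_index_enum.
Qed.

End Ramanujan.

(** * Combinatorial properties as two-valuedness *)

Lemma two_valued_inj (V : finZmodType) (A : {set V}) (T U : Type)
    (f : T -> U) (N : V -> T) (M : V -> U) :
  injective f -> (forall x, M x = f (N x)) -> two_valued A M <-> two_valued A N.
Proof.
move=> inj_f eM; split=> tv x y nz_x nz_y eA; last by rewrite !eM (tv x y).
by apply: inj_f; rewrite -!eM; apply: tv.
Qed.

Lemma triple_sum_setP (R : finComUnitRingType) (C : numFieldType) k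
    (S : {set 'cV[R]_k}) : unit_stable S ->
  triple_sum_set S <-> two_valued S (conv_pow 3 (fun x => (x \in S)%:R : C)).
Proof.
move=> stS.
have inj_z : injective (fun i : int => i%:~R : C) by apply: intr_inj.
pose N h := #|triple_sums S h|%:Z.
rewrite (two_valued_inj S inj_z (N := N)); last first.
  by move=> h; rewrite -card_triple_sums -pmulrn.
by rewrite -two_valuedP; split=> [[]|].
Qed.

(** Adjoining 0 to the connection set amounts to adding one loop. *)
Lemma looped_setU0 (R : finComUnitRingType) (C : numFieldType) k
    (A : {set 'cV[R]_k}) : 0 \notin A ->
  looped A (1 : C) =1 fun x => (x \in 0 |: A)%:R.
Proof.
move=> A0 x; rewrite /looped /delta mul1r in_setU1.
by have [->|_] := eqVneq x 0; rewrite ?(negbTE A0) ?add0r ?addr0.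
Qed.

Lemma eq_conv_pow (R : finComUnitRingType) (C : numFieldType) k l
    (f g : 'cV[R]_k -> C) : f =1 g -> conv_pow l f =1 conv_pow l g.
Proof.
move=> fg; elim: l => // l IHl x.
by apply: eq_bigr => y _; rewrite fg; congr (_ * _); apply: IHl.
Qed.

Lemma eq_two_valued (V : finZmodType) (A : {set V}) (T : Type) (N M : V -> T) :
  N =1 M -> two_valued A N <-> two_valued A M.
Proof. by move=> eN; apply: (two_valued_inj A (f := id)). Qed.

(** The graph is the Cayley graph of R^k since the syndromes are all the
    vectors. Closed walks impose nothing: translations make their number the
    same at every vertex. *)
Lemma swrg3P (R : finComUnitRingType) (C : numFieldType) k n
    (Omega : {set 'cV[R]_k}) (H : 'M[R]_(k, n)) b :
    unit_stable Omega -> unit_representatives Omega H -> generating Omega ->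
  swrg (syndrome_graph H b) 3
  <-> two_valued Omega (conv_pow 3 (looped Omega b%:R : _ -> C)).
Proof.
move=> stO reprH genO.
have ontoH := generating_onto genO reprH.
pose vtx v : vertex (syndrome_graph H b) := exist _ v (mem_syndromes ontoH v).
pose N v := (nb_walks 3 (vtx v) (vtx 0))%:Z.
have walksE := nb_walks_conv_pow stO reprH ontoH C.
have inj_z : injective (fun i : int => i%:~R : C) by apply: intr_inj.
have walksN (x y : vertex (syndrome_graph H b)) :
  (nb_walks 3 x y)%:Z = N (val x - val y).
  by apply: inj_z; rewrite -!pmulrn !walksE /= subr0.
have adjE x y := @adjacent_syndrome _ _ _ _ _ stO reprH b x y.
rewrite (two_valued_inj Omega inj_z (N := N)); last first.
  by move=> v; rewrite -pmulrn walksE /= subr0.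
rewrite -two_valuedP; split=> [[s0 [s1 [s sE]]]|[s0 [s1 NE]]].
  exists s0, s1 => v nz_v.
  have ne_v0 : vtx v != vtx 0 by rewrite -val_eqE.
  by rewrite /N sE (negbTE ne_v0) adjE //= subr0.
exists s0, s1, (N 0) => x y; rewrite walksN.
have [->|ne_xy] := eqVneq x y; first by rewrite subrr.
by rewrite adjE // NE // subr_eq0 val_eqE.
Qed.

(** * The eigenvalues in terms of the weights *)

Section Weights.
Variables (p m k n : nat).
Hypothesis p_prime : prime p.
Hypothesis m_gt0 : (0 < m)%N.
Variable Omega : {set 'cV['Z_(p ^ m)]_k}.
Hypothesis Omega_regular : Omega \subset regular_vectors 'Z_(p ^ m) k.
Hypothesis Omega_stable : unit_stable Omega.
Hypothesis Omega_gen : generating Omega.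
Variable H : 'M['Z_(p ^ m)]_(k, n).
Hypothesis H_repr : unit_representatives Omega H.

Lemma regular_neq0 : 0 \notin Omega.
Proof.
apply/negP => /(subsetP Omega_regular) /regular_scale_inj/(_ 0 1).
by rewrite !scaler0 => /(_ erefl)/esym/eqP; rewrite oner_eq0.
Qed.

Definition valency : rat := n%:R * (p%:R - 1) * p%:R ^+ m.-1.

Lemma fourier_Omega z h : (p ^ m)%N.-primitive_root z ->
  fourier (chi (m := m) z) (fun x => (x \in Omega)%:R) h
  = ratr (valency - p%:R * word_hom_weight (H^T *m h)).
Proof.
move=> z_prim.
transitivity (\sum_(x in Omega) chi z (dot h x)).
  rewrite [RHS]big_mkcond; apply: eq_bigr => x _.
  by case: (x \in Omega); rewrite ?mul1r ?mul0r.
rewrite (sum_unit_orbits H_repr) //.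
under eq_bigr => j _ do under eq_bigr => u _ do rewrite dotZr.
under eq_bigr => j _ do rewrite (sum_chi_unit p_prime m_gt0 z_prim).
rewrite -rmorph_sum /= sumrB sumr_const card_ord -mulr_sumr.
congr (ratr (_ - _ * _)).
  by rewrite -[LHS]mulr_natl mulrA.
apply: eq_bigr => j _; congr hom_weight.
by rewrite mxE; apply: eq_bigr => i _; rewrite !mxE mulrC.
Qed.

Variables w1 w2 w3 : rat.
Hypothesis w12 : w1 < w2.
Hypothesis w23 : w2 < w3.
Hypothesis weights : forall w : rat,
  (w != 0 /\ code_hom_weight (dual (code H)) w) <-> w \in [:: w1; w2; w3].

Lemma weights_rows w :
  (exists2 h, h != 0 & word_hom_weight (H^T *m h) = w)
  <-> w \in [:: w1; w2; w3].
Proof.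
rewrite -weights; split=> [[h nz_h <-]|[_ [c [dual_c]]]].
  have nz_Hh : H^T *m h != 0 by rewrite (trmx_mul_eq0 Omega_gen H_repr).
  split; first by rewrite (word_hom_weight_eq0 p_prime).
  exists (H^T *m h); split=> //.
  by apply/(dual_codeP Omega_gen H_repr); exists h.
have /(dual_codeP Omega_gen H_repr)[h ->] := dual_c.
by rewrite (trmx_mul_eq0 Omega_gen H_repr) => nz_h <-; exists h.
Qed.

Lemma two_valued_weights b :
  two_valued Omega (conv_pow 3 (looped Omega b%:R : _ -> algC))
  <-> w1 + w2 + w3 = 3%:R * ((b%:R + valency) / p%:R).
Proof.
have [z z_prim] := C_prim_root_exists (ltnW (expn_prime_gt1 p_prime m_gt0)).
have nz_p : (p%:R : rat) != 0 by rewrite pnatr_eq0 -lt0n prime_gt0.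
pose eig w : algC := ratr (b%:R + valency - p%:R * w).
have eig_inj : injective eig.
  by move=> w w' /(fmorph_inj _)/addrI/oppr_inj/(mulfI nz_p).
have ne_eig w w' : w < w' -> eig w != eig w'.
  by move=> lt_ww; rewrite (inj_eq eig_inj) lt_eqF.
have c0 := chi0 p m z.
have cD := chiD p_prime m_gt0 z_prim.
rewrite (two_valued_conv3 c0 cD (chi_faithful p_prime m_gt0 z_prim)
  regular_neq0 (ne_eig _ _ w12)
  (ne_eig _ _ (lt_trans w12 w23)) (ne_eig _ _ w23)).
  rewrite -!rmorphD /=; split=> [/eqP|e].
    rewrite fmorph_eq0 => /eqP e; apply: (mulfI nz_p).
    apply/eqP; rewrite -subr_eq0 -[X in _ == X]oppr0 -e; apply/eqP; field.
    exact: nz_p.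
  apply/eqP; rewrite fmorph_eq0; apply/eqP.
  transitivity (3%:R * (b%:R + valency) - p%:R * (w1 + w2 + w3)); first by ring.
  by rewrite e; field.
move=> t; rewrite -[_ \in _]/(t \in [seq eig w | w <- [:: w1; w2; w3]]).
have eigE h : fourier (chi z) (looped Omega b%:R) h
              = eig (word_hom_weight (H^T *m h)).
  rewrite fourier_looped // fourier_Omega // -(ratr_nat _ b) -rmorphD /=.
  by rewrite addrC addrA.
split=> [[h nz_h <-]|/mapP[w /weights_rows[h nz_h <-] ->]]; last by exists h.
by rewrite eigE map_f //; apply/weights_rows; exists h.
Qed.

End Weights.

Theorem theorem6 (p m k n : nat)
    (p_prime : prime p) (m_gt0 : (0 < m)%N)
    (Omega : {set 'cV['Z_(p ^ m)]_k})
    (Omega_regular : Omega \subset regular_vectors 'Z_(p ^ m) k)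
    (Omega_stable : unit_stable Omega)
    (Omega_gen : generating Omega)
    (H : 'M['Z_(p ^ m)]_(k, n))
    (H_repr : unit_representatives Omega H)
    (w1 w2 w3 : rat)
    (w12 : w1 < w2) (w23 : w2 < w3)
    (weights : forall w : rat,
       (w != 0 /\ code_hom_weight (dual (code H)) w) <->
       w \in [:: w1; w2; w3])
    (b : nat) :
  [/\ triple_sum_set Omega <->
        w1 + w2 + w3 = 3%:R * n%:R * (p%:R - 1) * p%:R ^ (m%:Z - 2),
      triple_sum_set (0 |: Omega) <->
        w1 + w2 + w3 = 3%:R * ((1 + n%:R * (p%:R - 1) * p%:R ^+ m.-1) / p%:R)
    & swrg (syndrome_graph H b) 3 <->
        w1 + w2 + w3 = 3%:R * ((b%:R + n%:R * (p%:R - 1) * p%:R ^+ m.-1) / p%:R)].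
Proof.
have crit c := two_valued_weights p_prime m_gt0 Omega_regular Omega_stable
  Omega_gen H_repr w12 w23 weights c.
have Omega0 := regular_neq0 Omega_regular.
split.
- rewrite (triple_sum_setP algC) //.
  rewrite (_ : _ * _ ^ _ = 3%:R * ((0%:R + valency p m n) / p%:R)); last first.
    have nz_p : (p%:R : rat) != 0 by rewrite pnatr_eq0 -lt0n prime_gt0.
    by rewrite /valency -mul_exprz_sub2 // mulr0n; field.
  rewrite -crit; apply/eq_two_valued/eq_conv_pow => x.
  by rewrite /looped mul0r addr0.
- have stable0 : unit_stable (0 |: Omega).
    move=> u w Uu; rewrite !in_setU1 => /orP[/eqP->|/(Omega_stable u w Uu)->].
      by rewrite scaler0 eqxx.
    by rewrite orbT.
  rewrite (triple_sum_setP algC) // -[1]/(1%:R) -(crit 1).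
  rewrite -(eq_two_valued _ (eq_conv_pow 3 (looped_setU0 algC Omega0))).
  split=> tv x y nz_x nz_y eA; apply: tv => //; move: eA;
    by rewrite !in_setU1 (negbTE nz_x) (negbTE nz_y).
by rewrite (swrg3P algC b Omega_stable H_repr Omega_gen) crit.
Qed.
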